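(* Let $\Delta$ be the marked group $\mathbb{Z}/3\mathbb{Z}\rtimes_\varphi\mathbb{Z}$, where $\varphi:\mathbb{Z}\to\mathrm{Aut}(\mathbb{Z}/3\mathbb{Z})$ sends $1$ to the inversion map (so the product is $(a,m)(b,n)=(a+(-1)^m b, m+n)$), with generating set $\{(1,0),(2,0),(0,1),(0,-1)\}$. Then $\chi_B(F(2^\Delta))=4$.
   Context: A marked group is a finitely generated group $\Gamma$ with a finite symmetric generating set $S$ not containing the identity. The left shift action of $\Gamma$ on $2^\Gamma$ is $(g\cdot x)(h)=x(g^{-1}h)$; its free part is $F(2^\Gamma)=\{x\in 2^\Gamma : g\cdot x\neq x \text{ for all } g\neq \mathrm{id}\}$. The shift graph $F(2^\Gamma)$ is the graph on this free part joining distinct $x,y$ iff $s\cdot x=y$ for some $s\in S$. $\chi_B(G)$ denotes the Borel chromatic number: the least $k$ such that there is a Borel map $c$ from the vertex set to a $k$-element set with $c(x)\neq c(y)$ for adjacent $x,y$. *)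

(* Defs.v *)
From HB Require Import structures.
From mathcomp Require Import all_boot all_order all_algebra.
From mathcomp Require Import boolp classical_sets functions.
From mathcomp Require Import topology measure.

Set Implicit Arguments.
Unset Strict Implicit.
Unset Printing Implicit Defensive.

Import GRing.Theory.

Local Open Scope classical_set_scope.
Local Open Scope group_scope.

Record markedGroup := MarkedGroup {
  mg_group :> groupType;
  mg_gens : seq mg_group;
  mg_gens_sym : {in mg_gens, forall s, s^-1 \in mg_gens};
  mg_gens_neq1 : 1 \notin mg_gens;
  mg_gens_generate : forall g : mg_group,
    exists2 w : seq mg_group, {subset w <= mg_gens} & g = \prod_(s <- w) s }.

Record topGraph := TopGraph {
  vertices :> topologicalType;
  adj : vertices -> vertices -> Prop;
  adj_sym : forall x y, adj x y -> adj y x;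
  adj_irrefl : forall x, ~ adj x x }.

Section BorelChromaticNumber.
Variable V : topGraph.

Definition borel_set (A : set V) : Prop := <<s @open V >> A.

(* The finite set of colours carries the discrete Borel structure. *)
Definition borel_map k (c : V -> 'I_k) : Prop :=
  forall A : set 'I_k, borel_set (c @^-1` A).

Definition proper_coloring k (c : V -> 'I_k) : Prop :=
  forall x y, adj x y -> c x <> c y.

Definition borel_colorable k : Prop :=
  exists2 c : V -> 'I_k, borel_map c & proper_coloring c.

(* "chi_B(V) = k": a relation rather than a function, because the least
   number of colours need not be finite. *)
Definition has_borel_chromatic_number k : Prop :=
  borel_colorable k /\ (forall j, borel_colorable j -> (k <= j)%N).

End BorelChromaticNumber.

Arguments has_borel_chromatic_number : clear implicits.

Section ShiftGraph.
Variable G : markedGroup.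

Definition shift (g : G) (x : {ptws G -> bool}) : {ptws G -> bool} :=
  fun h => x (g^-1 * h).

Definition free_part : set {ptws G -> bool} :=
  [set x | forall g, g <> 1 -> shift g x <> x].

Definition shift_adj (x y : free_part) : Prop :=
  x <> y /\ (exists2 s, s \in mg_gens G & shift s (set_val x) = set_val y).

Fact shift_adj_sym x y : shift_adj x y -> shift_adj y x.
Proof.
move=> [xy [s sS sxy]]; split; first by move/esym.
exists s^-1; first exact: mg_gens_sym.
by rewrite -sxy; apply/funext => h; rewrite /shift invgK mulKg.
Qed.

Fact shift_adj_irrefl x : ~ shift_adj x x.
Proof. by case. Qed.

(* The vertex type is [free_part] with the subspace topology inherited from the
   product topology on [{ptws G -> bool}], [bool] being discrete. *)
Definition shift_graph : topGraph := TopGraph shift_adj_sym shift_adj_irrefl.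

End ShiftGraph.

Definition Delta_carrier : Type := 'Z_3 * int.
HB.instance Definition _ := Choice.on Delta_carrier.

Section DeltaGroup.
Local Open Scope ring_scope.

Definition Delta_phi (m : int) (a : 'Z_3) : 'Z_3 := (-1) ^ m * a.

Definition Delta_mul (x y : Delta_carrier) : Delta_carrier :=
  (x.1 + Delta_phi x.2 y.1, x.2 + y.2).

Definition Delta_one : Delta_carrier := (0, 0).

Definition Delta_inv (x : Delta_carrier) : Delta_carrier :=
  (- Delta_phi (- x.2) x.1, - x.2).

Lemma Delta_phi1 a : Delta_phi 1 a = - a.
Proof. by rewrite /Delta_phi expr1z mulN1r. Qed.

Lemma Delta_phiD m n a : Delta_phi (m + n) a = Delta_phi m (Delta_phi n a).
Proof. by rewrite /Delta_phi exprzDr ?unitrN1 // mulrA. Qed.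

Lemma Delta_phi0 a : Delta_phi 0 a = a.
Proof. by rewrite /Delta_phi expr0z mul1r. Qed.

Fact Delta_mulA : associative Delta_mul.
Proof.
move=> [a m] [b n] [c p]; rewrite /Delta_mul /= Delta_phiD addrA.
by rewrite {1 4 5}/Delta_phi mulrDr !addrA.
Qed.

Fact Delta_mul1 : left_id Delta_one Delta_mul.
Proof. by move=> [a m]; rewrite /Delta_mul /= Delta_phi0 !add0r. Qed.

Fact Delta_mulr1 : right_id Delta_one Delta_mul.
Proof.
by move=> [a m]; rewrite /Delta_mul /= {1}/Delta_phi mulr0 !addr0.
Qed.

Fact Delta_mulV : left_inverse Delta_one Delta_inv Delta_mul.
Proof. by move=> [a m]; rewrite /Delta_mul /= !addNr. Qed.

Fact Delta_mulrV : right_inverse Delta_one Delta_inv Delta_mul.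
Proof.
move=> [a m]; rewrite /Delta_mul /Delta_inv /= subrr.
have -> : Delta_phi m (- Delta_phi (- m) a) = - a; last by rewrite subrr.
by rewrite {1}/Delta_phi mulrN -/(Delta_phi m _) -Delta_phiD subrr Delta_phi0.
Qed.

HB.instance Definition _ := isGroup.Build Delta_carrier
  Delta_mulA Delta_mul1 Delta_mulr1 Delta_mulV Delta_mulrV.

Definition Delta_gens : seq Delta_carrier :=
  [:: (1, 0); (2, 0); (0, 1); (0, -1)].

End DeltaGroup.

Fact Delta_gens_sym : {in Delta_gens, forall s, s^-1 \in Delta_gens}.
Proof. by apply/allP. Qed.

Fact Delta_gens_neq1 : 1 \notin Delta_gens.
Proof. by []. Qed.

Fact Delta_gens_generate (g : Delta_carrier) :
  exists2 w : seq Delta_carrier, {subset w <= Delta_gens} & g = \prod_(s <- w) s.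
Proof.
pose P (g : Delta_carrier) := exists2 w : seq Delta_carrier,
  {subset w <= Delta_gens} & g = \prod_(s <- w) s.
have PM x y : P x -> P y -> P (x * y).
  move=> [v vS ->] [w wS ->]; exists (v ++ w); last by rewrite big_cat.
  by move=> s; rewrite mem_cat => /orP[/vS|/wS].
have PS s : s \in Delta_gens -> P s.
  by move=> sS; exists [:: s]; [move=> t; rewrite inE => /eqP->|rewrite big_seq1].
have P1 : P 1 by exists [::]; rewrite ?big_nil.
have PZ n : P (0%R, n).
  elim/int_ind: n => [|n IH|n IH]; first exact: P1.
    have -> : (0%R, Posz n.+1) = Delta_mul (0%R, 1%R) (0%R, Posz n).
      by congr (_, _); rewrite ?intS // Delta_phi1 oppr0 addr0.
    by apply: PM IH; apply: PS.
  have -> : (0%R, (- (n.+1)%:Z)%R) = Delta_mul (0%R, (-1)%R) (0%R, (- n%:Z)%R).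
    by congr (_, _); [rewrite /= /Delta_phi mulr0 addr0|rewrite intS opprD].
  by apply: PM IH; apply: PS.
case: g => a n.
have -> : (a, n) = Delta_mul (a, 0%R) (0%R, n).
  by congr (_, _); rewrite /= ?Delta_phi0 ?addr0 ?add0r.
apply: PM (PZ n); case: a => -[|[|[|//]]] lta.
- by rewrite (_ : Ordinal lta = 0%R); [exact: P1|exact: val_inj].
- by apply: PS; rewrite (_ : Ordinal lta = 1%R)//; exact: val_inj.
- by apply: PS; rewrite (_ : Ordinal lta = 2%R)//; exact: val_inj.
Qed.

Definition Delta : markedGroup :=
  MarkedGroup Delta_gens_sym Delta_gens_neq1 Delta_gens_generate.

(* Main.v *)
(** Write [a = (1, 0)] and [t = (0, 1)], so that [t a = a^-1 t]; the orbits of [a]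
    are triangles, and [t] joins each triangle to the next by a perfect matching.

    Lower bound. A 3-colouring [c] is a bijection on every triangle, and passing to
    the next triangle permutes the colours by a derangement, that is, a 3-cycle.
    As [t] reverses the cyclic order of the triangles, the orientation
    [o x := (c (a x) = c x + 1)] satisfies [o (t x) = ~ o x]. If [c] is Borel then
    [o] is locally constant on a comeager set, so [o y = o x0] as soon as [y] is
    generic and agrees with [x0] on some finite set [F]. For [n] odd and large, the
    conditions that [y] and [t^n y] both agree with [x0] on [F] are compatible, and a
    generic such [y] contradicts [o (t^n y) = ~ o y].

    Upper bound. The greedy algorithm gives a relatively clopen maximal set of
    markers no two of which lie in the same or in adjacent triangles. The marked
    triangles are then 2 or 3 steps apart along [t]; counting from the markers
    colours the marked triangles by [0, 1, 2], and every gap can be filled in with 4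
    colours by a rule that looks at boundedly many triangles. *)

From HB Require Import structures.
From mathcomp Require Import all_boot all_order all_algebra.
From mathcomp Require Import boolp classical_sets functions.
From mathcomp Require Import topology measure zify.
Require Import Defs.

Set Implicit Arguments.
Unset Strict Implicit.
Unset Printing Implicit Defensive.

Local Open Scope classical_set_scope.
Local Open Scope group_scope.

(** * Cylinders in the product topology and locally constant functions *)

Section LocallyConstant.
Variable G : markedGroup.
Local Notation cantor := {ptws G -> bool}.
Implicit Types (x y : cantor) (F : seq G) (g h : G).

Lemma shift1 x : shift 1 x = x.
Proof. by apply/funext => h; rewrite /shift invg1 mul1g. Qed.

Lemma shiftM g h x : shift g (shift h x) = shift (g * h) x.
Proof. by apply/funext => k; rewrite /shift invgM mulgA. Qed.

Lemma shift_free g x : free_part x -> free_part (shift g x).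
Proof.
move=> fx h h1 hgx; apply: (fx (g^-1 * h * g)).
  move=> e; apply: h1; apply: (mulgI g^-1); apply: (mulIg g).
  by rewrite e mulg1 mulVg.
by rewrite -2!shiftM hgx shiftM mulVg shift1.
Qed.

Lemma nbhs_cylinder x (F : seq G) : nbhs x [set y : cantor | {in F, y =1 x}].
Proof.
elim: F => [|h F IH]; first by apply: filterS filterT.
have xh : nbhs x [set y : cantor | y h = x h].
  have /(_ x) := @proj_continuous G (fun=> bool) h.
  by move=> /(_ [set x h]); apply; exact: discrete_set1.
apply: filterS (filterI xh IH) => y [/= yh yF] k.
by rewrite inE => /orP[/eqP->//|/yF].
Qed.

(** The sets containing a cylinder about [x] form a filter [N]. It converges to [x], since
    convergence in the product topology is coordinatewise, so it contains every open set around
    [x]. *)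
Lemma open_cylinder (U : set cantor) x : open U -> U x ->
  exists F : seq G, forall y, {in F, y =1 x} -> U y.
Proof.
move=> oU Ux.
pose N : set_system cantor :=
  [set A | exists F : seq G, forall y, {in F, y =1 x} -> A y].
have fN : Filter N.
  split=> [|A B [E EA] [F FB]|A B AB [F FA]].
  - by exists [::].
  - exists (E ++ F) => y yx; split; [apply: EA|apply: FB] => h hF;
      by apply: yx; rewrite mem_cat hF ?orbT.
  - by exists F => y /FA/AB.
have : {ptws, N --> x}.
  apply/cvg_sup => h; apply/cvg_image.
    by apply/seteqP; split=> // b _; exists (fun=> b).
  move=> A /nbhs_singleton Ah; exists [set y : cantor | A (y h)].
    by exists [:: h] => y yx; rewrite /= yx ?mem_head.
  by apply/seteqP; split=> [_ [y Ay <-]//|b Ab]; exists (fun=> b).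
by apply; exact: open_nbhs_nbhs.
Qed.

Lemma open_free_part (A : set (shift_graph G)) :
  (forall z, A z -> exists F : seq G, forall w : shift_graph G,
     {in F, set_val w =1 set_val z} -> A w) -> open A.
Proof.
move=> HA; rewrite openE => z /HA[F FA].
have zF : nbhs z [set w : shift_graph G | {in F, set_val w =1 set_val z}].
  exact: (@initial_continuous (@free_part G) cantor set_val z
    _ (nbhs_cylinder (set_val z) F)).
by apply: filterS zF => w /FA.
Qed.

Lemma open_free_part_cylinder (A : set (shift_graph G)) z : open A -> A z ->
  exists F : seq G, forall w : shift_graph G,
     {in F, set_val w =1 set_val z} -> A w.
Proof.
move=> [U oU <-] /= Uz; have [F FU] := open_cylinder oU Uz.
by exists F => w /FU.
Qed.

(** Stated at a point, as it will be proved at free points while [y] ranges over the whole space. *)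
Definition locally_constant (T : Type) (f : cantor -> T) x : Prop :=
  exists F : seq G, forall y, {in F, y =1 x} -> f y = f x.

Section Combinators.
Variables (T : Type) (x : cantor).
Implicit Type f : cantor -> T.

Lemma locally_constant_eval h : locally_constant (fun y => y h) x.
Proof. by exists [:: h] => y; apply; rewrite mem_head. Qed.

Lemma locally_constant_shift g f :
  locally_constant f (shift g x) -> locally_constant (fun y => f (shift g y)) x.
Proof.
move=> [F Ff]; exists [seq g^-1 * h | h <- F] => y yx; apply: Ff => h hF.
by rewrite /shift yx // map_f.
Qed.

Lemma locally_constant_all (I : eqType) (s : seq I) (f : I -> cantor -> T) :
  {in s, forall i, locally_constant (f i) x} ->
  exists F : seq G, forall y, {in F, y =1 x} -> {in s, forall i, f i y = f i x}.
Proof.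
elim: s => [_|i s IH fs]; first by exists [::].
have [E Ef] := fs i (mem_head _ _).
have [|F Ff] := IH; first by move=> j js; apply: fs; rewrite inE js orbT.
exists (E ++ F) => y yx j; rewrite inE => /orP[/eqP->|js].
  by apply: Ef => h hE; apply: yx; rewrite mem_cat hE.
by apply: (Ff y) => // h hF; apply: yx; rewrite mem_cat hF orbT.
Qed.

Lemma locally_constant_dep (I : eqType) (s : seq I) (T' : Type)
    (f : I -> cantor -> T) (f' : cantor -> T') :
  {in s, forall i, locally_constant (f i) x} ->
  (forall y, {in s, forall i, f i y = f i x} -> f' y = f' x) ->
  locally_constant f' x.
Proof.
by move=> /locally_constant_all[F Ff] ff'; exists F => y /Ff/ff'.
Qed.

End Combinators.

End LocallyConstant.

(** * Greedy maximal independent sets *)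

Definition least (P : pred nat) : nat :=
  if pselect (exists n, P n) is left exP then ex_minn exP else 0.

Lemma leastP (P : pred nat) n :
  P n -> P (least P) /\ (forall m, P m -> (least P <= m)%N).
Proof.
move=> Pn; rewrite /least; case: pselect => [exP|[]]; last by exists n.
by case: ex_minnP.
Qed.

Section MaximalIndependentSet.
Variables (G : markedGroup) (e : nat -> G) (S : seq G).
Hypothesis e_surj : forall g, exists n, e n = g.
Hypothesis S1 : 1 \notin S.
Hypothesis S_sym : {in S, forall s, s^-1 \in S}.
Local Notation cantor := {ptws G -> bool}.
Implicit Types (x y : cantor) (s : G).

(** The first [n] points of the enumeration already witness that [x] differs from each of its
    translates by [S]. *)
Definition separated n x : bool :=
  all (fun s => has (fun i => x (s^-1 * e i) != x (e i)) (iota 0 n)) S.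

Lemma separated_free x : free_part x -> exists n, separated n x.
Proof.
move=> fx; rewrite /separated; move: S1; elim: S => [|s s' IH]; first by exists 0.
rewrite inE negb_or => /andP[s1 /IH[n sepn]].
have [h xh] : exists h, x (s^-1 * h) != x h.
  apply: contrapT => nx; apply: (fx s); first by move=> s1'; rewrite s1' eqxx in s1.
  by apply/funext => h; apply/eqP/negPn/negP => xh; apply: nx; exists h.
have [i ei] := e_surj h; exists (maxn n i.+1) => /=; apply/andP; split.
  apply/hasP; exists i; last by rewrite ei.
  by rewrite mem_iota leq_max ltnSn orbT.
apply: sub_all sepn => k /hasP[j jn xj]; apply/hasP; exists j => //.
by move: jn; rewrite !mem_iota /= !add0n => jn; rewrite leq_max jn.
Qed.

Lemma separated_locally_constant n x : locally_constant (separated n) x.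
Proof.
apply: (@locally_constant_dep _ _ _ _
  ([seq e i | i <- iota 0 n] ++ [seq s^-1 * e i | s <- S, i <- iota 0 n])
  _ (fun h y => y h)) => [h _|y yx]; first exact: locally_constant_eval.
apply: eq_in_all => s sS; apply: eq_in_has => i iI; rewrite !yx //.
  by rewrite mem_cat map_f.
by rewrite mem_cat; apply/orP; right; apply: allpairs_f.
Qed.

(* The shortest initial pattern of [x] that tells [x] apart from its
   neighbours, as a number: a proper colouring with countably many colours. *)
Definition pattern x : nat :=
  pickle [seq x (e i) | i <- iota 0 (least (separated^~ x))].

(** Equal patterns have the same length [n], so [x] and [shift s x] would agree on the first [n]
    points, although [n] separates them. *)
Lemma pattern_neq s x : s \in S -> free_part x -> pattern (shift s x) <> pattern x.
Proof.
move=> sS fx /(pcan_inj pickleK) epat.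
have [n sepn] := separated_free fx.
have [sepx _] := leastP (P := separated^~ x) sepn.
have esz := congr1 size epat; rewrite !size_map !size_iota in esz.
rewrite esz in epat.
have /hasP[i iI /negP] := allP sepx s sS; apply; apply/eqP.
exact: ((eq_in_map _ _ _).2 epat i iI).
Qed.

(** The length [n] of the pattern is decided by [separated m] for [m <= n]: finitely many locally
    constant functions. *)
Lemma pattern_locally_constant x : free_part x -> locally_constant pattern x.
Proof.
move=> fx; have [k sepk] := separated_free fx.
have [] := leastP (P := separated^~ x) sepk; set n := least _ => sepn min_n.
have [|E Ex] := @locally_constant_all G bool x nat (iota 0 n.+1) separated.
  by move=> m _; exact: separated_locally_constant.
exists (E ++ [seq e i | i <- iota 0 n]) => y yx.
have {}Ex : {in iota 0 n.+1, forall m, separated m y = separated m x}.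
  by apply: Ex => h hE; apply: yx; rewrite mem_cat hE.
have yn : least (separated^~ y) = n.
  have := Ex n; rewrite sepn mem_iota ltnSn => /(_ isT).
  move=> sepy; have [] := leastP (P := separated^~ y) sepy.
  set m := least _ => sepm min_m.
  have mn := min_m _ sepy; apply/eqP; rewrite eqn_leq mn min_n //.
  by rewrite -Ex // mem_iota.
rewrite /pattern yn -/n; congr pickle; apply/eq_in_map => i iI.
by apply: yx; rewrite mem_cat map_f ?orbT.
Qed.

(* [n] is the recursion fuel; any value above [pattern x] gives membership in
   the greedy independent set. *)
Fixpoint greedy_rec n x : bool :=
  if n is n'.+1 then
    ~~ has (fun s => (pattern (shift s x) < pattern x)%N
                     && greedy_rec n' (shift s x)) S
  else false.

Definition greedy x : bool := greedy_rec (pattern x).+1 x.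

(** Recursive calls that count go to a strictly smaller [pattern], so sufficient fuel stays
    sufficient. *)
Lemma greedy_recE n x : (pattern x < n)%N -> greedy_rec n x = greedy x.
Proof.
suff rec_eq m : (pattern x < n)%N -> (pattern x < m)%N ->
    greedy_rec n x = greedy_rec m x by move=> xn; exact: rec_eq.
elim: n m x => [//|n IH] [//|m] x xn xm /=; congr (~~ _); apply: eq_has => s.
by case: ltnP => //= sx; apply: IH; exact: leq_trans sx _.
Qed.

Lemma greedyE x : greedy x =
  ~~ has (fun s => (pattern (shift s x) < pattern x)%N && greedy (shift s x)) S.
Proof.
rewrite {1}/greedy /=; congr (~~ _); apply: eq_has => s.
by case: ltnP => //= /greedy_recE.
Qed.

(** The two patterns differ, and the point with the larger one is rejected on account of the
    other. *)
Lemma greedy_independent s x :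
  s \in S -> free_part x -> greedy x -> ~~ greedy (shift s x).
Proof.
move=> sS fx gx; apply/negP => gsx.
have : pattern (shift s x) != pattern x by apply/eqP; exact: pattern_neq.
rewrite neq_ltn => /orP[lt|lt].
  by move: gx; rewrite greedyE => /hasPn/(_ s sS); rewrite lt gsx.
move: gsx; rewrite greedyE => /hasPn/(_ _ (S_sym sS)).
by rewrite shiftM mulVg shift1 lt gx.
Qed.

Lemma greedy_maximal x : greedy x \/ exists2 s, s \in S & greedy (shift s x).
Proof.
case gx: (greedy x); [by left|right].
by move: gx; rewrite greedyE => /negbFE/hasP[s sS /andP[_ gsx]]; exists s.
Qed.

(** The fuel is itself locally constant, and for fixed fuel the recursion consults finitely many
    translates. *)
Lemma greedy_locally_constant x : free_part x -> locally_constant greedy x.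
Proof.
have rec_lc n y : free_part y -> locally_constant (greedy_rec n) y.
  elim: n y => [|n IH] y fy; first by exists [::].
  apply: (@locally_constant_dep _ _ _ _ (1 :: S) _
    (fun s z => (pattern (shift s z), greedy_rec n (shift s z)))) => [s _|z zy].
    have fsy := shift_free (g := s) fy; apply: (locally_constant_shift (f := fun z =>
      (pattern z, greedy_rec n z))).
    have [E Ey] := pattern_locally_constant fsy.
    have [F Fy] := IH _ fsy.
    exists (E ++ F) => z zy; rewrite Ey ?Fy// => h hF; apply: zy;
      by rewrite mem_cat hF ?orbT.
  rewrite /=; congr (~~ _); apply: eq_in_has => s sS.
  have := zy 1 (mem_head _ _); rewrite !shift1 => -[-> _].
  by have := zy s; rewrite inE sS orbT => /(_ isT) [-> ->].
move=> fx; have [E Ex] := pattern_locally_constant fx.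
have [F Fx] := rec_lc (pattern x).+1 x fx.
exists (E ++ F) => y yx; rewrite /greedy Ex ?Fx// => h hF; apply: yx;
  by rewrite mem_cat hF ?orbT.
Qed.

End MaximalIndependentSet.

(** * The Borel 4-colouring *)

Section FourColoring.
Local Notation cantor := {ptws Delta -> bool}.
Implicit Types x y : cantor.

Definition Delta_a : Delta := (1%R, 0%R) : Delta_carrier.
Definition Delta_t : Delta := (0%R, 1%R) : Delta_carrier.
Local Notation a := Delta_a.
Local Notation t := Delta_t.

Definition Delta_enum (n : nat) : Delta :=
  odflt (1 : Delta_carrier) (unpickle n : option ('Z_3 * int)%type).

Lemma Delta_enum_surj g : exists n, Delta_enum n = g.
Proof.
by exists (pickle (g : ('Z_3 * int)%type)); rewrite /Delta_enum pickleK.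
Qed.

(* The nontrivial [a ^ i * t ^ j] with [|j| <= 1]. *)
Definition Delta_near : seq Delta :=
  [:: (1, 0); (2, 0); (0, 1); (1, 1); (2, 1);
      (0, -1); (1, -1); (2, -1)]%R : seq Delta_carrier.

Lemma Delta_near_neq1 : 1 \notin Delta_near.
Proof. by []. Qed.

Lemma Delta_near_sym : {in Delta_near, forall s, s^-1 \in Delta_near}.
Proof. by apply/allP. Qed.

Definition marker : cantor -> bool := greedy Delta_enum Delta_near.

(* The place of [x] in its triangle [x, a x, a^2 x], counted from the marker of
   that triangle, if there is one. *)
Definition place x : option nat :=
  if marker x then Some 0%N
  else if marker (shift a^-1 x) then Some 1%N
  else if marker (shift a x) then Some 2%N else None.

Lemma marker_near s x : s \in Delta_near -> free_part x ->
  marker x -> marker (shift s x) = false.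
Proof.
move=> sS fx mx; apply/negbTE.
exact: (greedy_independent Delta_enum_surj Delta_near_neq1 Delta_near_sym).
Qed.

Definition turn k : option nat -> option nat := omap (fun i => (i + k) %% 3).

(** A triangle contains at most one marker, so the order of the tests in [place] does not matter. *)
Lemma place_a x : free_part x -> place (shift a x) = turn 1 (place x).
Proof.
move=> fx; rewrite /place !shiftM mulVg shift1.
have -> : a * a = a^-1 by apply/eqP.
have aP : a \in Delta_near by [].
have a'P : a^-1 \in Delta_near by [].
case mx: (marker x); first by rewrite (marker_near aP).
case m'x: (marker (shift a^-1 x)).
  have := marker_near a'P (shift_free (g := a^-1) fx) m'x.
  by rewrite shiftM (_ : a^-1 * a^-1 = a) => [->|]; last exact/eqP.
by case: (marker (shift a x)).
Qed.

(** Markers in adjacent triangles would differ by some [h * t * g^-1], which lies in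
    [Delta_near]. *)
Lemma place_adjacent x : free_part x -> place x -> place (shift t x) = None.
Proof.
move=> fx px.
have [g gI mgx] : exists2 g : Delta, g \in [:: 1; a^-1; a] & marker (shift g x).
  move: px; rewrite /place; case: ifP => [mx _|_].
    by exists 1; rewrite ?shift1.
  case: ifP => [mx _|_]; first by exists a^-1.
  by case: ifP => // mx _; exists a.
have nm h : h \in [:: 1; a^-1; a] -> marker (shift h (shift t x)) = false.
  move=> hI; rewrite shiftM -[h * t](mulgVK g) -shiftM.
  apply: (marker_near _ (shift_free fx) mgx).
  move: g h gI hI {px mgx}; have :
    all (fun g => all (fun h => h * t * g^-1 \in Delta_near) [:: 1; a^-1; a])
      [:: 1; a^-1; a] by [].
  by move=> /allP H g h gI hI; exact: (allP (H _ gI)).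
have := nm 1 (mem_head _ _); rewrite shift1 /place => ->.
by rewrite !nm // !inE eqxx ?orbT.
Qed.

Lemma place_near x : free_part x ->
  [|| place (shift t^-1 x), place x | place (shift t x)].
Proof.
have pm g y : g \in [:: 1; a^-1; a] -> marker (shift g y) -> place y.
  rewrite !inE /place => /or3P[]/eqP->; rewrite ?shift1 => ->; by do ?case: ifP.
move=> fx; have [mx|[s sS msx]] := greedy_maximal Delta_enum Delta_near x.
  by apply/or3P/Or32/(pm 1); rewrite ?shift1.
(* Every near element is a power of [a] times some [u] among [t^-1], [1], [t], so a marker at
   [shift s x] marks the triangle of [shift u x]. *)
have : all (fun s => has (fun u => s * u^-1 \in [:: 1; a^-1; a]) [:: t^-1; 1; t])
  Delta_near by [].
move=> /allP/(_ s sS)/hasP[u uI suI].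
have pux : place (shift u x) by apply: pm suI _; rewrite shiftM mulgVK.
by move: uI pux; rewrite !inE => /or3P[]/eqP->; rewrite ?shift1 => ->; rewrite ?orbT.
Qed.

(* [u], [v], [w], [z] are the places at [t^-2 x], [t^-1 x], [x], [t x]. The
   triangle before a marked one is filled in between a proper 3-colouring [p] of
   its predecessor and the 3-colouring [q] by places of its successor; only when
   the gap between the two markers has odd length do [p] and [q] have opposite
   orientations, which forces the use of the colour 3. *)
Definition window_color (u v w z : option nat) : nat :=
  if w is Some i then i else
  if z is Some q then
    if v is Some p then
      if q == (p + 1) %% 3 then (p + 2) %% 3 else (p + 1) %% 3
    else if u is Some p' then
      let p := (p' + 1) %% 3 in
      if q == p then (p + 1) %% 3
      else if q == (p + 1) %% 3 then (p + 2) %% 3 else 3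
    else 0
  else if v is Some p then (p + 1) %% 3 else 0.

Definition places : seq (option nat) :=
  [:: None; Some 0%N; Some 1%N; Some 2%N].

Definition sparse (u v : option nat) : bool := ~~ (u && v).

Definition dense3 (u v w : option nat) : bool := [|| u : bool, v | w].

Definition legal (u v w z : option nat) : bool :=
  [&& sparse u v, sparse v w, sparse w z, dense3 u v w & dense3 v w z].

(** An exhaustive check of bound, [a]-edges and [t]-edges, with [z'] the place at [t^2 x]. Passing
    to [a x] turns [v] and [z] by 2 because [t a = a^-1 t]. Legality excludes the windows on which
    [window_color] falls back to 0. *)
Lemma window_colorP :
  all (fun u => all (fun v => all (fun w => all (fun z => all (fun z' =>
    legal u v w z ==>
    [&& (window_color u v w z < 4)%N,
      window_color u v w z
        != window_color (turn 1 u) (turn 2 v) (turn 1 w) (turn 2 z)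
    & sparse z z' && dense3 w z z' ==>
      (window_color u v w z != window_color v w z z')])
  places) places) places) places) places.
Proof. by vm_compute. Qed.

Definition color4 x : nat :=
  window_color (place (shift (t^-1 * t^-1) x)) (place (shift t^-1 x))
    (place x) (place (shift t x)).

Lemma place_in x : place x \in places.
Proof. by rewrite /place; do 3?case: ifP. Qed.

Lemma legal_places x : free_part x ->
  legal (place (shift (t^-1 * t^-1) x)) (place (shift t^-1 x))
    (place x) (place (shift t x)).
Proof.
have sp y z : free_part y -> shift t y = z -> sparse (place y) (place z).
  move=> fy <-; rewrite /sparse; case py: (place y) => [i|//] /=.
  by rewrite place_adjacent // py.
move=> fx; apply/and5P; split.
- by apply: sp; [exact: shift_free|rewrite shiftM mulVKg].
- by apply: sp; [exact: shift_free|rewrite shiftM mulgV shift1].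
- exact: sp.
- have := place_near (shift_free (g := t^-1) fx).
  by rewrite !shiftM mulgV shift1.
- exact: place_near.
Qed.

Lemma color4_lt x : free_part x -> (color4 x < 4)%N.
Proof.
move=> fx; have := window_colorP.
move=> /allP/(_ _ (place_in (shift (t^-1 * t^-1) x))).
move=> /allP/(_ _ (place_in (shift t^-1 x))).
move=> /allP/(_ _ (place_in x)) /allP/(_ _ (place_in (shift t x))).
move=> /allP/(_ _ (place_in x)).
by rewrite legal_places //= => /and3P[].
Qed.

Lemma color4_a x : free_part x -> color4 x <> color4 (shift a x).
Proof.
move=> fx; have pV y : free_part y -> place (shift a^-1 y) = turn 2 (place y).
  move=> fy; rewrite (_ : a^-1 = a * a); last exact/eqP.
  rewrite -shiftM !place_a //; last exact: shift_free.
  by have := place_in y; rewrite !inE => /or4P[]/eqP->.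
have := window_colorP.
move=> /allP/(_ _ (place_in (shift (t^-1 * t^-1) x))).
move=> /allP/(_ _ (place_in (shift t^-1 x))).
move=> /allP/(_ _ (place_in x)) /allP/(_ _ (place_in (shift t x))).
move=> /allP/(_ _ (place_in x)).
rewrite legal_places //= => /and3P[_ /eqP + _].
rewrite -!pV -?place_a; try exact: shift_free; last by [].
rewrite /color4 !shiftM.
have -> : a^-1 * t^-1 = t^-1 * a by apply/eqP.
have -> : a * (t^-1 * t^-1) = t^-1 * t^-1 * a by apply/eqP.
by have -> : a^-1 * t = t * a by apply/eqP.
Qed.

Lemma color4_t x : free_part x -> color4 x <> color4 (shift t x).
Proof.
move=> fx; have := window_colorP.
move=> /allP/(_ _ (place_in (shift (t^-1 * t^-1) x))).
move=> /allP/(_ _ (place_in (shift t^-1 x))).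
move=> /allP/(_ _ (place_in x)) /allP/(_ _ (place_in (shift t x))).
move=> /allP/(_ _ (place_in (shift t (shift t x)))).
rewrite legal_places //= => /and3P[_ _].
have := legal_places (shift_free (g := t) fx).
rewrite /color4 !shiftM mulVg shift1 mulgVK => /and5P[_ _ -> _ ->] /eqP.
exact.
Qed.

Lemma color4_locally_constant x : free_part x -> locally_constant color4 x.
Proof.
have plc y : free_part y -> locally_constant place y.
  move=> fy; apply: (@locally_constant_dep _ _ _ _ [:: 1; a^-1; a] _
    (fun g z => marker (shift g z))) => [g _|z zy].
    apply: locally_constant_shift; apply: greedy_locally_constant.
    - exact: Delta_enum_surj.
    - exact: Delta_near_neq1.
    - exact: shift_free.
  have := zy 1 (mem_head _ _); rewrite !shift1 /place => ->.
  by rewrite !zy ?inE ?eqxx ?orbT.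
move=> fx; apply: (@locally_constant_dep _ _ _ _ [:: t^-1 * t^-1; t^-1; 1; t] _
    (fun g z => place (shift g z))) => [g _|z zx].
  by apply: locally_constant_shift; apply: plc; exact: shift_free.
have := zx 1; rewrite !inE eqxx !orbT !shift1 => /(_ isT) z1.
by rewrite /color4 z1 !zx // !inE eqxx ?orbT.
Qed.

Lemma borel_colorable_shift_Delta : borel_colorable (shift_graph Delta) 4.
Proof.
have fz (z : shift_graph Delta) : free_part (set_val z) by exact: set_valP.
pose c (z : shift_graph Delta) : 'I_4 := inord (color4 (set_val z)).
exists c => [A|z w [_ [s sS szw]]].
  (* Local constancy makes preimages open, hence Borel. *)
  apply: sub_gen_smallest; apply: open_free_part => z Az.
  have [F Fz] := color4_locally_constant (fz z).
  by exists F => w /Fz wz; rewrite /= /c wz.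
move=> /(congr1 val); rewrite /= !inordK; try exact: color4_lt.
(* Edges along [a^-1] and [t^-1] reduce to those along [a] and [t] by exchanging endpoints. *)
have flip g x y : shift g x = y -> shift g^-1 y = x.
  by move=> <-; rewrite shiftM mulVg shift1.
have : s \in [:: a; a^-1; t; t^-1] by move: s sS {szw}; apply/allP.
rewrite !inE => /or4P[]/eqP es; move: szw; rewrite es.
- by move=> <-; exact: color4_a.
- by move=> /flip; rewrite invgK => <-; apply/nesym; exact: color4_a.
- by move=> <-; exact: color4_t.
- by move=> /flip; rewrite invgK => <-; apply/nesym; exact: color4_t.
Qed.

End FourColoring.

(** * Baire category and the Baire property of Borel sets *)

Section BaireCategory.
Variable G : markedGroup.
Local Notation cantor := {ptws G -> bool}.
Implicit Types (x y : cantor) (F : seq G) (U C : set cantor).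

Definition cylinder_open U : Prop :=
  forall x, U x -> exists F, forall y, {in F, y =1 x} -> U y.

Definition cylinder_dense U : Prop :=
  forall x F, exists2 y, {in F, y =1 x} & U y.

Definition comeager C : Prop :=
  exists2 D : nat -> set cantor,
    forall n, cylinder_open (D n) /\ cylinder_dense (D n) &
    forall x, (forall n, D n x) -> C x.

(** The Baire category theorem: a decreasing sequence of cylinders is built, the one at stage
    [n + 1] lying inside [D n]. *)
Lemma comeager_dense C : comeager C -> cylinder_dense C.
Proof.
move=> [D Dod DC] x0 F0.
pose good n (p q : cantor * seq G) :=
  [/\ {subset p.2 <= q.2}, {in p.2, q.1 =1 p.1}
    & forall y, {in q.2, y =1 q.1} -> D n y].
have step (np : nat * (cantor * seq G)) : exists q, good np.1 np.2 q.
  case: np => n [x F] /=; have [oD dD] := Dod n.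
  have [y yx Dy] := dD x F; have [E Ey] := oD y Dy.
  exists (y, F ++ E); split=> //= [h hF|z zy]; first by rewrite mem_cat hF.
  by apply: Ey => h hE; apply: zy; rewrite mem_cat hE orbT.
have [next nextP] := choice step.
pose p := fix p n := if n is m.+1 then next (m, p m) else (x0, F0).
have goodp n : good n (p n) (p n.+1) := nextP (n, p n).
have pmono m n : (m <= n)%N ->
    {subset (p m).2 <= (p n).2} /\ {in (p m).2, (p n).1 =1 (p m).1}.
  elim: n => [|n IH]; first by rewrite leqn0 => /eqP->; split.
  rewrite leq_eqVlt => /orP[/eqP->|/IH[sub eqp]]; first by split.
  have [sub' eqp' _] := goodp n; split=> h hm; first exact/sub'/sub.
  by rewrite eqp' ?eqp ?sub.
(* Each coordinate is read at the first stage that fixes it; coordinates never fixed get [false]. *)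
pose y : cantor := fun h =>
  if pselect (exists n, h \in (p n).2) is left ex then (p (ex_minn ex)).1 h
  else false.
have yp n : {in (p n).2, y =1 (p n).1}.
  move=> h hn; rewrite /y; case: pselect => [ex|[]]; last by exists n.
  case: ex_minnP => m hm min_m; have [_ ->//] := pmono _ _ (min_m _ hn).
exists y; first exact: (yp 0).
by apply: DC => n; have [_ _] := goodp n; apply; exact: yp.
Qed.

Lemma comeager_sub C C' : comeager C -> (forall x, C x -> C' x) -> comeager C'.
Proof. by move=> [D Dod DC] CC'; exists D => // x /DC/CC'. Qed.

Lemma cylinder_open_dense_comeager U :
  cylinder_open U -> cylinder_dense U -> comeager U.
Proof. by move=> oU dU; exists (fun=> U) => // x /(_ 0). Qed.

Lemma comeager_bigcap (C : nat -> set cantor) :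
  (forall n, comeager (C n)) -> comeager [set x | forall n, C n x].
Proof.
move=> Cn.
have /choice[D DP] n : exists D : nat -> set cantor,
    (forall m, cylinder_open (D m) /\ cylinder_dense (D m)) /\
    (forall x, (forall m, D m x) -> C n x).
  by have [D Dod DC] := Cn n; exists D.
exists (fun k => let nm := odflt (0, 0)%N (unpickle k) in D nm.1 nm.2).
  by move=> k; exact: (DP _).1.
move=> x Dx n; apply: (DP n).2 => m; have := Dx (pickle (n, m)).
by rewrite pickleK.
Qed.

Lemma comeagerI C C' : comeager C -> comeager C' -> comeager (C `&` C').
Proof.
move=> cC cC'.
apply: comeager_sub (@comeager_bigcap (fun n => if n is 0 then C else C') _) _.
  by case.
by move=> x Cx; split; [exact: (Cx 0)|exact: (Cx 1%N)].
Qed.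

Lemma comeager_shift g C : comeager C -> comeager [set x | C (shift g x)].
Proof.
move=> [D Dod DC]; exists (fun n => [set x | D n (shift g x)]); last first.
  by move=> x Dx; exact: DC.
move=> n; have [oD dD] := Dod n; split=> [x /oD[F FD]|x F].
  exists [seq g^-1 * h | h <- F] => y yx; apply: FD => h hF.
  by rewrite /shift yx ?map_f.
have [y yx Dy] := dD (shift g x) [seq g * h | h <- F].
exists (shift g^-1 y); last by rewrite /= shiftM mulgV shift1.
by move=> h hF; rewrite /shift invgK yx ?map_f// /shift mulKg.
Qed.

Hypothesis G_infinite : forall F, exists h, h \notin F.

Lemma comeager_free (e : nat -> G) :
  (forall g, exists n, e n = g) -> comeager (@free_part G).
Proof.
move=> e_surj.
pose D n : set cantor := [set x | e n <> 1 -> shift (e n) x <> x].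
apply: (@comeager_sub [set x | forall n, D n x]) => [|x Dx g]; last first.
  by have [n <-] := e_surj g; exact: Dx.
apply: comeager_bigcap => n; set g := e n.
case: (EM (g = 1)) => g1.
  apply: cylinder_open_dense_comeager => [x _|x F].
    by exists [::] => y _ /(_ g1).
  by exists x => // /(_ g1).
apply: cylinder_open_dense_comeager => [x /(_ g1) gx|x F].
  have [h xh] : exists h, x (g^-1 * h) <> x h.
    by apply/existsNP => xh; apply: gx; apply/funext.
  exists [:: g^-1 * h; h] => y yx _ gy; apply: xh.
  by rewrite -!yx ?inE ?eqxx ?orbT// -[in RHS]gy.
have [h hF] := G_infinite (F ++ [seq g * k | k <- F]).
move: hF; rewrite mem_cat negb_or => /andP[hF hgF].
(* The value at [h], outside [F], is free; it is set so that [y] and [shift g y] differ at [h]. *)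
pose y : cantor := fun k => if k == h then ~~ x (g^-1 * h) else x k.
exists y => [k kF|_ gy]; first by rewrite /y; case: eqP => // kh; rewrite -kh kF in hF.
have := congr1 (fun f : cantor => f h) gy; rewrite /shift /y eqxx.
case: eqP => [gh|_]; last by case: (x _).
by move=> _; apply: g1; apply: invg_inj; apply: (mulIg h); rewrite gh invg1 mul1g.
Qed.

(* For [P] the membership in a set [A], this says that [A] has the Baire
   property. *)
Definition generically_constant (T : Type) (P : cantor -> T) : Prop :=
  exists2 C, comeager C &
    forall x, C x -> exists F, forall y, C y -> {in F, y =1 x} -> P y = P x.

Lemma generically_constant_ext (T : Type) (P Q : cantor -> T) :
  comeager [set x | P x = Q x] -> generically_constant P -> generically_constant Q.
Proof.
move=> cPQ [C cC CP]; exists (C `&` [set x | P x = Q x]); first exact: comeagerI.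
move=> x [Cx <-]; have [F FP] := CP x Cx; exists F => y [Cy <-]; exact: FP.
Qed.

(** [U] together with the interior [W] of its complement is open and dense, and membership in [U] is
    locally constant there. *)
Lemma cylinder_open_generically_constant U :
  cylinder_open U -> generically_constant U.
Proof.
move=> oU.
pose W : set cantor := [set x | exists F, forall y, {in F, y =1 x} -> ~ U y].
exists (U `|` W).
  apply: cylinder_open_dense_comeager => [x [/oU[F FU]|[F FW]]|x F].
  - by exists F => y yx; left; exact: FU.
  - exists F => y yx; right; exists F => z zy.
    by apply: FW => h hF; rewrite zy ?yx.
  - case: (EM (exists2 y, {in F, y =1 x} & U y)) => [[y yx Uy]|nU].
      by exists y => //; left.
    by exists x => //; right; exists F => y yx Uy; apply: nU; exists y.
move=> x [Ux|[F FW]].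
  have [F FU] := oU x Ux; exists F => y _ yx.
  by apply/propext; split=> // _; exact: FU.
exists F => y _ yx; apply/propext; split=> H; exfalso; last exact: (FW x).
exact: (FW y).
Qed.

(** The union agrees, on the intersection of the [C n], with the open set [V] of points having a
    cylinder on which some [P n] holds throughout [C n]. *)
Lemma generically_constant_bigcup (P : nat -> cantor -> Prop) :
  (forall n, generically_constant (P n)) ->
  generically_constant (fun x => exists n, P n x).
Proof.
move=> Pn.
have /choice[C CP] n : exists C, comeager C /\
    (forall x, C x -> exists F, forall y, C y -> {in F, y =1 x} -> P n y = P n x).
  by have [C cC CPn] := Pn n; exists C.
pose V : set cantor := [set x | exists n F, forall y, C n y ->
  {in F, y =1 x} -> P n y].
have oV : cylinder_open V.
  move=> x [n [F Fx]]; exists F => y yx; exists n, F => z Cz zy.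
  by apply: Fx => // h hF; rewrite zy ?yx.
apply: generically_constant_ext (cylinder_open_generically_constant oV).
apply: (@comeager_sub [set x | forall n, C n x]).
  by apply: comeager_bigcap => n; exact: (CP n).1.
move=> x Cx; apply/propext; split=> [[n [F FV]]|[n Px]].
  by exists n; exact: FV.
have [E Ex] := (CP n).2 x (Cx n).
by exists n, E => z Cz zx; rewrite (Ex z Cz zx).
Qed.

Hypothesis comeager_free_part : comeager (@free_part G).

(** Category arguments take place in the full product, where points can be prescribed
    coordinatewise; the free part is comeager there. *)
Definition extend (A : set (shift_graph G)) x : Prop :=
  exists2 z : shift_graph G, set_val z = x & A z.

(** The sets with this property form a sigma-algebra containing the open sets. *)
Lemma borel_generically_constant (A : set (shift_graph G)) :
  borel_set A -> generically_constant (extend A).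
Proof.
apply: (@smallest_sub _ _ _ [set A | generically_constant (extend A)]) => [|U oU].
  split=> /= [|B|B Bn].
  - exists setT; first by apply: comeager_sub comeager_free_part _.
    by move=> x _; exists [::] => y _ _; apply/propext; split=> -[].
  - rewrite setTD => -[C cC CB]; exists (C `&` @free_part G); first exact: comeagerI.
    have extC x : free_part x -> extend (~` B) x = ~ extend B x.
      move=> fx; apply/propext; split=> [[z zx nBz] [w wx Bw]|nB].
        by apply: nBz; rewrite (_ : z = w)//; apply: val_inj; rewrite [LHS]zx.
      have [z zx] : exists z : shift_graph G, set_val z = x.
        by exists (exist _ x (mem_set fx)).
      by exists z => // Bz; apply: nB; exists z.
    move=> x [Cx fx]; have [F FB] := CB x Cx; exists F => y [Cy fy] yx.
    by rewrite !extC // FB.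
  - have -> : extend (\bigcup_k B k) = (fun x => exists n, extend (B n) x).
      apply/funext => x; apply/propext; split=> [[z zx [n _ Bz]]|[n [z zx Bz]]].
        by exists n, z.
      by exists z => //; exists n.
    exact: generically_constant_bigcup.
case: oU => O oO <-.
have oO' : cylinder_open O by move=> x; exact: open_cylinder.
apply: generically_constant_ext (cylinder_open_generically_constant oO').
apply: comeager_sub comeager_free_part _ => x fx; apply/propext.
split=> [Ox|[z <-]//]; by exists (exist _ x (mem_set fx)).
Qed.

End BaireCategory.

(** * Closure properties of generic constancy *)

Section GenericallyConstantShift.
Variables (G : markedGroup) (T : Type) (P : {ptws G -> bool} -> T).

Lemma generically_constant_shift g :
  generically_constant P -> generically_constant (fun x => P (shift g x)).
Proof.
move=> [C cC CP]; exists [set x | C (shift g x)]; first exact: comeager_shift.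
move=> x /CP[F FP]; exists [seq g^-1 * h | h <- F] => y Cy yx.
by apply: FP => // h hF; rewrite /shift yx ?map_f.
Qed.

Lemma generically_constant_pair (T' : Type) (Q : {ptws G -> bool} -> T') :
  generically_constant P -> generically_constant Q ->
  generically_constant (fun x => (P x, Q x)).
Proof.
move=> [C cC CP] [C' cC' CQ]; exists (C `&` C'); first exact: comeagerI.
move=> x [/CP[E EP] /CQ[F FQ]]; exists (E ++ F) => y [Cy C'y] yx.
rewrite EP // ?FQ // => h hF; apply: yx; by rewrite mem_cat hF ?orbT.
Qed.

Lemma generically_constant_comp (T' : Type) (f : T -> T') :
  generically_constant P -> generically_constant (fun x => f (P x)).
Proof.
move=> [C cC CP]; exists C => // x /CP[F FP].
by exists F => y Cy yx; rewrite FP.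
Qed.

End GenericallyConstantShift.

(** * No Borel 3-colouring exists *)

Section LowerBound.
Local Notation cantor := {ptws Delta -> bool}.
Local Notation a := Delta_a.
Local Notation t := Delta_t.
Implicit Types x y : cantor.

Lemma Delta_bound (F : seq Delta) :
  exists n : nat, {in F, forall h : Delta, (`|(h : Delta_carrier).2|%R <= n%:Z)%R}.
Proof.
elim: F => [|h F [n Fn]]; first by exists 0.
exists (maxn n `|(h : Delta_carrier).2|) => k; rewrite inE => /orP[/eqP->|/Fn]; lia.
Qed.

Lemma Delta_infinite (F : seq Delta) : exists h, h \notin F.
Proof.
have [n Fn] := Delta_bound F; exists ((0, n.+1%:Z)%R : Delta_carrier).
by apply/negP => /Fn /=; lia.
Qed.

Lemma Delta_tX n (h : Delta) :
  (t ^+ n * h : Delta_carrier).2 = (n%:Z + (h : Delta_carrier).2)%R.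
Proof.
elim: n h => [|n IH] h; first by rewrite mul1g GRing.add0r.
by rewrite expgSr -mulgA IH /=; lia.
Qed.

Lemma Delta_translate_disjoint (F : seq Delta) :
  exists2 n, odd n & {in F, forall h, t ^+ n * h \notin F}.
Proof.
(* Second coordinates of [F] lie in [[-n, n]], and adding the odd number [2n + 1] moves them past
   [n]. *)
have [n Fn] := Delta_bound F; exists n.*2.+1; first by rewrite /= odd_double.
move=> h /Fn hn; apply/negP => /Fn; rewrite Delta_tX; lia.
Qed.

(* A Borel such [o] would contradict the generic ergodicity of [t ^+ 2]. *)
Lemma no_alternating (o : cantor -> bool) : generically_constant o ->
  (forall x, free_part x -> o (shift t x) = ~~ o x) -> False.
Proof.
move=> [C cC Co] ot.
have cfree : comeager (@free_part Delta).
  exact: (comeager_free Delta_infinite Delta_enum_surj).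
have otX n x : free_part x -> o (shift (t ^+ n) x) = odd n (+) o x.
  move=> fx; elim: n => [|n IH]; first by rewrite shift1.
  by rewrite expgS -shiftM ot ?IH ?addNb//; exact: shift_free.
have [x0 _ Cx0] := comeager_dense cC (fun=> true) [::].
have [F Fo] := Co x0 Cx0.
have [n n_odd Fn] := Delta_translate_disjoint F.
(* Both [y0] and its translate by [t ^+ n] agree with [x0] on [F]; the choice of [n] prevents a
   conflict. *)
pose y0 : cantor := fun h => if h \in F then x0 h else x0 (t ^+ n * h).
have [y yy0 [Cy [Cty fy]]] := comeager_dense
  (comeagerI cC (comeagerI (comeager_shift (t ^+ n) cC) cfree)) y0
  (F ++ [seq (t ^+ n)^-1 * h | h <- F]).
have oy : o y = o x0.
  by apply: Fo => // h hF; rewrite yy0 ?mem_cat ?hF// /y0 hF.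
have oty : o (shift (t ^+ n) y) = o x0.
  apply: Fo => // h hF; rewrite /shift yy0 ?mem_cat ?map_f ?orbT// /y0 mulVKg.
  by case: ifP => // /Fn; rewrite mulVKg hF.
by move: oty; rewrite otX // n_odd oy; case: (o x0).
Qed.

(** The [c] are the colours at [x], [a x], [a^-1 x] and the [d] those at [t x], [a t x], [a^-1 t x].
    The indices cross in [c1 != d2] and [c2 != d1] because [t a = a^-1 t]. *)
Lemma orientation_flip : let I := iota 0 3 in
  all (fun c0 => all (fun c1 => all (fun c2 =>
  all (fun d0 => all (fun d1 => all (fun d2 =>
    [&& c0 != c1, c1 != c2, c2 != c0, d0 != d1, d1 != d2, d2 != d0,
        c0 != d0, c1 != d2 & c2 != d1] ==>
    ((d1 == d0.+1 %% 3) == (c1 != c0.+1 %% 3))) I) I) I) I) I) I.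
Proof. by vm_compute. Qed.

Lemma borel_coloring_Delta_ge4 j : borel_colorable (shift_graph Delta) j -> (4 <= j)%N.
Proof.
move=> [c bc pc]; rewrite leqNgt; apply/negP => j4.
have cfree : comeager (@free_part Delta).
  exact: (comeager_free Delta_infinite Delta_enum_surj).
(* The colouring is extended to the whole space by 0 off the free part. *)
pose cc x : nat :=
  if pselect (exists z : shift_graph Delta, set_val z = x) is left ex
  then c (projT1 (cid ex)) else 0.
have ccE (z : shift_graph Delta) : cc (set_val z) = c z.
  rewrite /cc; case: pselect => [ex|[]]; last by exists z.
  by case: cid => w wz /=; congr (nat_of_ord (c _)); exact: val_inj.
have lift x : free_part x -> exists z : shift_graph Delta, set_val z = x.
  by move=> fx; exists (exist _ x (mem_set fx)).
have cc3 x : free_part x -> cc x \in iota 0 3.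
  move=> /lift[z <-]; rewrite ccE mem_iota /=.
  by apply: leq_trans (ltn_ord _) _.
have ccs (s : Delta) x : free_part x -> s \in Delta_gens -> cc x != cc (shift s x).
  move=> fx sS; apply/eqP.
  have [[z zx] [w wx]] := (lift _ fx, lift _ (shift_free (g := s) fx)).
  rewrite -wx -zx !ccE => /val_inj; apply: pc; split.
    move=> zw; apply: (fx s); last by rewrite -wx -zx zw.
    by move=> s1; move: sS; rewrite s1.
  by exists s => //; rewrite zx wx.
have gcc : generically_constant cc.
  (* The colour classes are Borel; indexing them by all naturals lets [comeager_bigcap] combine
     their comeager sets. *)
  pose A i : set (shift_graph Delta) := c @^-1` [set k | val k = i].
  have /choice[C CP] i : exists C, comeager C /\ (forall x, C x ->
      exists F : seq Delta, forall y, C y -> {in F, y =1 x} ->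
        extend (A i) y = extend (A i) x).
    by have [C cC CA] := borel_generically_constant cfree (bc [set k | val k = i]);
      exists C.
  exists (@free_part Delta `&` [set x | forall i, C i x]).
    by apply: comeagerI => //; apply: comeager_bigcap => i; case: (CP i).
  move=> x [/lift[z zx] Cx]; have [_ /(_ x (Cx _))[F Fx]] := CP (c z).
  exists F => y [_ Cy] yx.
  have : extend (A (c z)) y by rewrite Fx //; exists z.
  by move=> [w <- /= cw]; rewrite -zx !ccE -cw.
pose o x := cc (shift a x) == (cc x).+1 %% 3.
apply: (@no_alternating o) => [|x fx].
  apply: (@generically_constant_comp _ _ (fun x => (cc (shift a x), cc x)) _
    (fun p => p.1 == p.2.+1 %% 3)).
  by apply: generically_constant_pair => //; exact: generically_constant_shift.
have fs g : free_part (shift g x) by exact: shift_free.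
(* This supplies all nine inequalities required by [orientation_flip]. *)
have ad (g h : Delta) : h * g^-1 \in Delta_gens -> cc (shift g x) != cc (shift h x).
  by move=> /(ccs _ _ (fs g)); rewrite shiftM mulgVK.
have := orientation_flip.
move=> /allP/(_ _ (cc3 _ (fs 1))) /allP/(_ _ (cc3 _ (fs a))).
move=> /allP/(_ _ (cc3 _ (fs a^-1))) /allP/(_ _ (cc3 _ (fs t))).
move=> /allP/(_ _ (cc3 _ (fs (a * t)))) /allP/(_ _ (cc3 _ (fs (a^-1 * t)))).
rewrite !ad // shift1 /o -shiftM => /eqP.
exact.
Qed.

End LowerBound.

Theorem theorem3 : has_borel_chromatic_number (shift_graph Delta) 4.
Proof.
by split; [exact: borel_colorable_shift_Delta|exact: borel_coloring_Delta_ge4].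
Qed.
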